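(* There exist absolute constants $0<c\le C<\infty$ such that for all $1\le q\le p\le\infty$, $1\le\sigma\le\theta\le\infty$, all $m,k\in\mathbb{N}$ and all $n\in\mathbb{Z}_+$ with $n\le\frac{mk}{2}$, $$c\,m^{\frac1q-\frac1p}k^{\frac1\sigma-\frac1\theta}\le d_n(B^{m,k}_{p,\theta},\,l^{m,k}_{q,\sigma})\le C\,m^{\frac1q-\frac1p}k^{\frac1\sigma-\frac1\theta}.$$
   Context: Convention: $1/\infty=0$. For $N\in\mathbb{N}$, $1\le s\le\infty$, $\|\cdot\|_{l_s^N}$ is the usual $\ell_s$ norm on $\mathbb{R}^N$. For $m,k\in\mathbb{N}$, $1\le p,\theta\le\infty$, $l^{m,k}_{p,\theta}$ is $\mathbb{R}^{mk}=\{(x_{i,j})_{1\le i\le m,\,1\le j\le k}\}$ with norm $\|x\|_{l^{m,k}_{p,\theta}}=\bigl\|\bigl(\|(x_{i,j})_{i=1}^m\|_{l_p^m}\bigr)_{j=1}^k\bigr\|_{l_\theta^k}$; $B^{m,k}_{p,\theta}$ is its (closed) unit ball. For a normed space $X$, $M\subset X$, $n\in\mathbb{Z}_+=\{0,1,2,\dots\}$, the Kolmogorov $n$-width is $d_n(M,X)=\inf_{L}\sup_{x\in M}\inf_{y\in L}\|x-y\|$, the infimum over linear subspaces $L\subset X$ of dimension at most $n$. *)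

(* Defs.v *)
From HB Require Import structures.
From mathcomp Require Import all_boot all_order all_algebra.
From mathcomp Require Import all_classical all_reals all_analysis.

Set Implicit Arguments.
Unset Strict Implicit.
Unset Printing Implicit Defensive.

Import Order.TTheory GRing.Theory Num.Theory.

Local Open Scope classical_set_scope.
Local Open Scope ring_scope.

(* The reciprocal 1/s of an exponent s in [1, +oo], with 1/+oo = 0. *)
Definition recip (R : realType) (s : \bar R) : R := fine (s^-1)%E.

(* Only meant for 1 <= s; the value at -oo is junk. *)
Definition lnorm (R : realType) (N : nat) (s : \bar R) (x : 'I_N -> R) : R :=
  match s with
  | r%:E => (\sum_(i < N) `|x i| `^ r) `^ r^-1
  | +oo%E => \big[Num.max/0]_(i < N) `|x i|
  | -oo%E => 0
  end.

(* The inner norm l_p^m runs over the first index, the outer norm l_theta^k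
   over the second one. *)
Definition mixed_norm (R : realType) (m k : nat) (p theta : \bar R)
    (x : 'M[R]_(m, k)) : R :=
  lnorm theta (fun j : 'I_k => lnorm p (fun i : 'I_m => x i j)).

Definition mixed_ball (R : realType) (m k : nat) (p theta : \bar R) :
    set 'M[R]_(m, k) :=
  [set x | mixed_norm p theta x <= 1].
Arguments mixed_ball {R} m k p theta.

(* Kolmogorov n-width of M in the finite-dimensional space V normed by nrm.
   It is computed in the complete lattice \bar R, so that the infima and the
   supremum need no boundedness or non-emptiness side conditions. *)
Definition kolmogorov_width (R : realType) (V : vectType R) (nrm : V -> R)
    (n : nat) (M : set V) : \bar R :=
  ereal_inf [set ereal_sup [set ereal_inf [set (nrm (x - y))%:E
                                          | y in [set y | y \in L]]
                           | x in M]
            | L in [set L : {vspace V} | (\dim L <= n)%N]].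

(* Main.v *)
(* For the upper bound take L = 0: by the power mean inequality the norm of a
   point of the ball is at most m^(1/q-1/p) k^(1/sigma-1/theta).
   For the lower bound with c = 1/2, let L have dimension at most N/2, N = mk.
   An extreme point Z of the section of the unit cube by the orthogonal
   complement of L has at least N/2 coordinates of modulus 1.  The multiple
   x = m^(-1/p) k^(-1/theta) sgn(Z) lies in the ball, and pairing with Z shows
   that its l_1 distance to L is at least |x|_oo N/2.  The power mean inequality
   transfers this bound from l_1 to l_{q,sigma}. *)
Require Import Defs.
From HB Require Import structures.
From mathcomp Require Import all_boot all_order all_algebra.
From mathcomp Require Import all_classical all_reals all_analysis.
From mathcomp Require Import ring lra.

Set Implicit Arguments.
Unset Strict Implicit.
Unset Printing Implicit Defensive.

Import Order.TTheory GRing.Theory Num.Theory.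

Local Open Scope classical_set_scope.
Local Open Scope ring_scope.

(** * Power mean inequality and comparison of the [lnorm] norms *)

(** Young's inequality for [t] and 1 with conjugate exponents [r] and [r / (r - 1)], multiplied by
    [r]. The case [r = 1] is separate, its conjugate exponent being infinite. *)
Lemma bernoulli_powR (R : realType) (r t : R) :
  1 <= r -> 0 <= t -> 1 + r * (t - 1) <= t `^ r.
Proof.
rewrite le_eqVlt => /predU1P[<- t0|r1 t0]; first by rewrite powRr1 //; lra.
have r0 : 0 < r by lra.
have r10 : 0 < r - 1 by lra.
have := @conjugate_powR R t 1 r (r / (r - 1)) t0 ler01 r0 (divr_gt0 r0 r10).
rewrite powR1 mulr1 => young.
have {young} : t <= t `^ r / r + 1 / (r / (r - 1)).
  by apply: young; field; rewrite !gt_eqF.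
rewrite -(ler_pM2l r0) => /le_trans => /(_ (t `^ r + (r - 1))).
have -> : r * (t `^ r / r + 1 / (r / (r - 1))) = t `^ r + (r - 1).
  by field; rewrite !gt_eqF.
by move=> /(_ (lexx _)); lra.
Qed.

Lemma sum_powR_ge0 (R : realType) (N : nat) (r : R) (b : 'I_N -> R) :
  0 <= \sum_i b i `^ r.
Proof. by apply: sumr_ge0 => i _; exact: powR_ge0. Qed.

Lemma power_mean (R : realType) (N : nat) (r : R) (b : 'I_N -> R) :
  (0 < N)%N -> 1 <= r -> (forall i, 0 <= b i) ->
  N%:R * ((\sum_i b i) / N%:R) `^ r <= \sum_i b i `^ r.
Proof.
move=> N0 r1 b0.
have N0' : 0 < N%:R :> R by rewrite ltr0n.
set mu := _ / _.
have : 0 <= mu by rewrite divr_ge0 ?sumr_ge0.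
rewrite le_eqVlt => /predU1P[<-|mu0].
  rewrite powR0 ?mulr0; last by rewrite gt_eqF //; lra.
  exact: sum_powR_ge0.
(* Sum of the tangent lines to the [r]-th power at the mean [mu]; the linear terms cancel. Each
   tangent lies below the power by [bernoulli_powR]. *)
have -> : N%:R * mu `^ r = \sum_i mu `^ r * (1 + r * (b i / mu - 1)).
  rewrite -mulr_sumr big_split /= -mulr_sumr sumrB -mulr_suml.
  rewrite !sumr_const card_ord.
  have -> : (\sum_i b i) / mu = N%:R.
    have -> : \sum_i b i = mu * N%:R by rewrite /mu divfK // gt_eqF.
    by field; rewrite gt_eqF.
  by rewrite subrr mulr0 addr0 mulrC.
apply: ler_sum => i _.
have -> : b i `^ r = mu `^ r * (b i / mu) `^ r.
  by rewrite -powRM ?[0 <= b i / _]divr_ge0 ?(ltW mu0) // mulrC divfK // gt_eqF.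
by rewrite ler_wpM2l ?powR_ge0 // bernoulli_powR // divr_ge0 // ltW.
Qed.

(** Case analysis that rewrites [s] and [recip s] together and leaves out the junk value at -oo. *)
Variant exponent_spec (R : realType) : \bar R -> R -> Type :=
  | ExponentFin r of 1 <= r : exponent_spec r%:E r^-1
  | ExponentInfty : exponent_spec +oo%E 0.

Lemma exponentP (R : realType) (s : \bar R) :
  (1 <= s)%E -> exponent_spec s (recip s).
Proof.
case: s => [r| |] //.
- rewrite lee_fin => r1; rewrite /recip fine_invr; exact: ExponentFin.
- by move=> _; rewrite /recip invey /=; exact: ExponentInfty.
Qed.

Lemma lnorm_ge0 (R : realType) (N : nat) (s : \bar R) (x : 'I_N -> R) :
  0 <= lnorm s x.
Proof.
by case: s => [r| |] //=; [exact: powR_ge0|exact: bigmax_ge_id].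
Qed.

Lemma le_lnorm (R : realType) (N : nat) (s : \bar R) (x y : 'I_N -> R) :
  (1 <= s)%E -> (forall i, `|x i| <= `|y i|) -> lnorm s x <= lnorm s y.
Proof.
case/exponentP => [r r1|] xy /=; last by apply: le_bigmax2 => i _.
have r0 : 0 <= r by lra.
rewrite ge0_ler_powR ?invr_ge0 ?nnegrE ?sum_powR_ge0 //.
by apply: ler_sum => i _; rewrite ge0_ler_powR ?nnegrE.
Qed.

Lemma lnormZ (R : realType) (N : nat) (s : \bar R) (a : R) (x : 'I_N -> R) :
  (1 <= s)%E -> 0 <= a -> lnorm s (fun i => a * x i) = a * lnorm s x.
Proof.
case/exponentP => [r r1|] a0 /=; last first.
  elim/big_rec2: _ => [|i y z _ ->]; first by rewrite mulr0.
  by rewrite normrM (ger0_norm a0) maxr_pMr.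
have r0 : r != 0 by rewrite gt_eqF //; lra.
under eq_bigr do rewrite normrM (ger0_norm a0) powRM //.
rewrite -mulr_sumr powRM ?powR_ge0 ?sum_powR_ge0 //.
by rewrite -powRrM mulfV // powRr1.
Qed.

Lemma lnorm1 (R : realType) (N : nat) (x : 'I_N -> R) :
  lnorm 1%E x = \sum_i `|x i|.
Proof.
rewrite /= invr1 powRr1 ?sum_powR_ge0 //.
by apply: eq_bigr => i _; rewrite powRr1.
Qed.

(** For finite exponents this is [power_mean] with exponent p/q, applied to the q-th powers of the
    moduli. For p infinite each modulus is bounded by the maximum. *)
Lemma lnorm_le_lnorm (R : realType) (N : nat) (q p : \bar R) (x : 'I_N -> R) :
  (0 < N)%N -> (1 <= q)%E -> (q <= p)%E ->
  lnorm q x <= N%:R `^ (recip q - recip p) * lnorm p x.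
Proof.
move=> N0 q1 qp; have p1 := le_trans q1 qp.
have N0' : 0 < N%:R :> R by rewrite ltr0n.
have nz : N%:R != 0 :> R by rewrite gt_eqF.
case: (exponentP q1) (exponentP p1) qp => [r r1|].
  have r0 : 0 < r by lra.
  have rV : r != 0 by rewrite gt_eqF.
  case=> [t t1|_] /=.
    have t0 : 0 < t by lra.
    have tV : t != 0 by rewrite gt_eqF.
    rewrite lee_fin => rt.
    have tr1 : 1 <= t / r by rewrite ler_pdivlMr // mul1r.
    have := @power_mean R N (t / r) (fun i => `|x i| `^ r) N0 tr1.
    move=> /(_ (fun i => powR_ge0 _ _)).
    under [X in _ <= X]eq_bigr do rewrite -powRrM mulrC divfK //.
    set S := \sum_i _; set T := \sum_i _ => ST.
    have S0 : 0 <= S by exact: sum_powR_ge0.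
    have T0 : 0 <= T by exact: sum_powR_ge0.
    (* The [t]-th root turns the exponent [t / r] into [r^-1], so both norms appear. *)
    have : (N%:R * (S / N%:R) `^ (t / r)) `^ t^-1 <= T `^ t^-1.
      by rewrite ge0_ler_powR ?nnegrE ?invr_ge0 ?mulr_ge0 ?powR_ge0 // ltW.
    rewrite powRM ?powR_ge0 ?ler0n // -powRrM.
    have -> : t / r * t^-1 = r^-1 by field; rewrite rV tV.
    rewrite powRM ?invr_ge0 ?ler0n // => H.
    rewrite powRB ?nz ?implybT //.
    have a0 : 0 < N%:R `^ t^-1 :> R by rewrite powR_gt0.
    have b0 : 0 < N%:R `^ r^-1 :> R by rewrite powR_gt0.
    move: H; rewrite -powR_inv1 ?ler0n // -powRrM mulN1r powRN.
    by rewrite mulrA ler_pdivrMr // [in X in _ -> X]mulrAC ler_pdivlMr //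
      mulrC [X in _ <= X -> _]mulrC.
  set M := \big[Num.max/_]_(_ < _) _.
  have M0 : 0 <= M by exact: bigmax_ge_id.
  have eM : M = (M `^ r) `^ r^-1 by rewrite -powRrM mulfV // powRr1.
  rewrite subr0 [M in leRHS]eM -powRM ?powR_ge0 ?ler0n //.
  rewrite ge0_ler_powR ?nnegrE ?invr_ge0 ?mulr_ge0 ?powR_ge0 ?ler0n
    ?sum_powR_ge0 ?(ltW r0) //.
  rewrite mulr_natl -[X in _ *+ X]card_ord -sumr_const; apply: ler_sum => i _.
  by rewrite ge0_ler_powR ?nnegrE ?(ltW r0) // /M; exact: le_bigmax.
by case=> // _; rewrite subrr powRr0 mul1r.
Qed.

(** * Mixed norms *)

(** [lnorm_le_lnorm] is used twice: inside each column, whose constant factor is pulled out by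
    homogeneity, then on the vector of column norms. *)
Lemma mixed_norm_le (R : realType) (m k : nat) (q p sigma theta : \bar R)
    (x : 'M[R]_(m, k)) :
  (0 < m)%N -> (0 < k)%N -> (1 <= q)%E -> (q <= p)%E ->
  (1 <= sigma)%E -> (sigma <= theta)%E ->
  mixed_norm q sigma x <= m%:R `^ (recip q - recip p) *
    k%:R `^ (recip sigma - recip theta) * mixed_norm p theta x.
Proof.
move=> m0 k0 q1 qp s1 st; rewrite /mixed_norm.
set A := _ `^ _.
have A0 : 0 <= A by exact: powR_ge0.
apply: (@le_trans _ _ (lnorm sigma (fun j => A * lnorm p (x^~ j)))).
  apply: le_lnorm => // j; rewrite normrM !ger0_norm ?lnorm_ge0 //.
  exact: lnorm_le_lnorm.
by rewrite lnormZ // -mulrA ler_wpM2l // lnorm_le_lnorm.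
Qed.

Lemma mixed_norm11 (R : realType) (m k : nat) (x : 'M[R]_(m, k)) :
  mixed_norm 1%E 1%E x = \sum_i \sum_j `|x i j|.
Proof.
rewrite /mixed_norm lnorm1 exchange_big; apply: eq_bigr => j _.
by rewrite ger0_norm ?lnorm_ge0 // lnorm1.
Qed.

Lemma mixed_normyy_le (R : realType) (m k : nat) (s : R) (x : 'M[R]_(m, k)) :
  0 <= s -> (forall i j, `|x i j| <= s) -> mixed_norm +oo%E +oo%E x <= s.
Proof.
move=> s0 xs; apply: bigmax_le => // j _; rewrite ger0_norm ?lnorm_ge0 //.
exact: bigmax_le.
Qed.

(** * Points of the cube orthogonal to a subspace *)

Lemma exists_ortho_vanishing (F : fieldType) (d N : nat) (A : 'M[F]_(d, N))
    (T : {set 'I_N}) :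
  (d + #|T| < N)%N ->
  exists w : 'rV[F]_N,
    [/\ w != 0, A *m w^T = 0 & forall i, i \in T -> w 0 i = 0].
Proof.
move=> dTN.
(* The rows of [D] are the unit vectors indexed by [T], so vanishing on [T] becomes further linear
   equations, fewer than [N] in all. *)
pose D : 'M[F]_(#|T|, N) := \matrix_l delta_mx 0 (enum_val l).
pose B := col_mx A D.
have : kermx B^T != 0.
  rewrite -mxrank_eq0 mxrank_ker -lt0n subn_gt0.
  exact: leq_ltn_trans (rank_leq_col _) dTN.
move=> /rowV0Pn[w /sub_kermxP wB w0]; exists w.
have /eq_col_mx[AW DW] : col_mx (A *m w^T) (D *m w^T) = col_mx 0 0.
  by rewrite -mul_col_mx -/B -[B]trmxK -trmx_mul wB trmx0 col_mx0.
split=> // i iT.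
have /matrixP/(_ (enum_rank_in iT i) 0) := DW.
rewrite !mxE (bigD1 i) //= big1 => [|j ji].
  by rewrite !mxE enum_rankK_in // !eqxx mul1r addr0.
by rewrite !mxE enum_rankK_in // (negbTE ji) andbF mul0r.
Qed.

(* Along a direction orthogonal to the rows of A and vanishing on the saturated
   coordinates, move until a further coordinate saturates. *)
Lemma exists_ortho_saturated (R : realFieldType) (d N : nat)
    (A : 'M[R]_(d, N)) (t : nat) :
  (d + t <= N)%N ->
  exists z : 'rV[R]_N, [/\ A *m z^T = 0, forall i, `|z 0 i| <= 1 &
    (t <= #|[set i | (`|z 0 i| == 1)%R]%SET|)%N].
Proof.
elim: t => [_|t IH]; last rewrite addnS => dtN.
  by exists 0; rewrite trmx0 mulmx0; split=> // i; rewrite mxE normr0.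
have [z [Az z1 tz]] := IH (ltnW dtN).
set T := [set i | `|z 0 i| == 1]%SET in tz.
have [tT|Tt] := ltnP t #|T|; first by exists z.
have [|w [w0 Aw wT]] := @exists_ortho_vanishing R d N A T.
  by rewrite (leq_ltn_trans _ dtN) // leq_add2l.
have [i0 wi0] : exists i, w 0 i != 0.
  by have /rV0Pn := w0.
(* [h i] is the time at which coordinate [i] of [z], moving along [w], reaches the face of the cube
   towards which it moves. The smallest such time is used. *)
pose h i := (1 - Num.sg (w 0 i) * z 0 i) / `|w 0 i|.
have [i wi hmin] := @arg_minP _ _ _ i0 (fun i => w 0 i != 0) h wi0.
set s := h i in hmin.
have sg1 j x : `|Num.sg (w 0 j) * x| <= `|x|.
  by rewrite normrM normr_sg; case: (_ != _); rewrite ?mul1r ?mul0r.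
have s0 : 0 <= s.
  rewrite divr_ge0 // subr_ge0 (le_trans (ler_norm _)) //.
  exact: le_trans (sg1 _ _) (z1 _).
(* After multiplication by the sign of [w 0 j] every moving coordinate increases, so only the bound
   1 can be violated, and minimality of [s] prevents that. *)
have sz j : w 0 j != 0 -> `|z 0 j + s * w 0 j| =
    `|Num.sg (w 0 j) * z 0 j + s * `|w 0 j| |.
  move=> wj; have -> : `|w 0 j| = Num.sg (w 0 j) * w 0 j by rewrite -normrEsg.
  by rewrite mulrCA -mulrDr normrM normr_sg wj mul1r.
exists (z + s *: w); split.
- by rewrite linearD linearZ /= mulmxDr -scalemxAr Az Aw scaler0 addr0.
- move=> j; rewrite !mxE; have [->|wj] := eqVneq (w 0 j) 0.
    by rewrite mulr0 addr0.
  rewrite sz // ler_norml; apply/andP; split.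
    have := sg1 j (z 0 j); have := z1 j => /[swap] /le_trans/[apply].
    rewrite ler_norml => /andP[+ _].
    by move=> /le_trans; apply; rewrite lerDl mulr_ge0.
  have := hmin j wj; rewrite ler_pdivlMr ?normr_gt0 //; lra.
(* Coordinates in [T] do not move, and the minimizing [i] is new because [w] is nonzero there. *)
- apply: (@leq_trans #|i |: T|).
    rewrite cardsU1 (_ : i \notin T) ?add1n ?ltnS //.
    by apply/negP => /wT /eqP; exact/negP.
  apply/subset_leq_card/fintype.subsetP => j; rewrite !inE => /predU1P[->|jT].
    rewrite !mxE sz // /s /h divfK ?normr_eq0 //.
    by rewrite addrC subrK normr1.
  by rewrite !mxE wT ?inE // mulr0 addr0.
Qed.

Lemma sum_mxvec (R : nmodType) (m k : nat) (F : 'I_(m * k) -> R) :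
  \sum_l F l = \sum_i \sum_j F (mxvec_index i j).
Proof.
rewrite pair_bigA (reindex _ (curry_mxvec_bij m k)) /=.
by apply: eq_bigr => -[i j].
Qed.

(** Matrices are flattened to vectors and the rows of [A] are a basis of [L]. Each saturated
    coordinate contributes 1 to the last sum. *)
Lemma exists_ortho_subspace (R : realFieldType) (m k : nat)
    (L : {vspace 'M[R]_(m, k)}) :
  exists Z : 'M[R]_(m, k), [/\
    forall y, y \in L -> \sum_i \sum_j y i j * Z i j = 0,
    forall i j, `|Z i j| <= 1 &
    (m * k - \dim L)%:R <= \sum_i \sum_j `|Z i j|].
Proof.
pose A : 'M[R]_(\dim L, m * k) := \matrix_l mxvec (vbasis L)`_l.
have dimL : (\dim L <= m * k)%N.
  by have := dimvS (subvf L); rewrite dimvf /dim /=.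
have [|z [Az z1 cz]] := @exists_ortho_saturated R _ _ A (m * k - \dim L).
  by rewrite subnKC.
exists (vec_mx z); split.
- move=> y yL.
  transitivity ((mxvec y *m z^T) 0 0).
    rewrite mxE sum_mxvec; do 2!apply: eq_bigr => ? _.
    by rewrite mxvecE !mxE.
  rewrite (coord_vbasis yL) linear_sum mulmx_suml summxE big1 // => l _.
  rewrite linearZ /= -scalemxAl mxE.
  have /matrixP/(_ l 0) := Az; rewrite [RHS]mxE => Azl.
  rewrite (_ : (_ *m _) 0 0 = 0) ?mulr0 // -[RHS]Azl !mxE.
  by apply: eq_bigr => j _; rewrite !mxE.
- by move=> i j; rewrite mxE.
- have -> : \sum_i \sum_j `|vec_mx z i j| = \sum_l `|z 0 l|.
    by rewrite sum_mxvec; do 2!apply: eq_bigr => ? _; rewrite mxE.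
  rewrite (bigID (mem [set l | `|z 0 l| == 1]%SET)) /=.
  rewrite (eq_bigr (fun=> 1)) => [|l]; last by rewrite inE => /eqP.
  by rewrite sumr_const -[leLHS]addr0 lerD ?sumr_ge0 ?ler_nat.
Qed.

(** * Bounds for the widths *)

Lemma width_le_mixed_norm (R : realType) (m k n : nat) (M : set 'M[R]_(m, k))
    (nrm : 'M[R]_(m, k) -> R) (a : R) :
  (forall x, M x -> nrm x <= a) -> (kolmogorov_width nrm n M <= a%:E)%E.
Proof.
move=> Ma; pose L0 : {vspace 'M[R]_(m, k)} := 0%VS.
have dL0 : (\dim L0 <= n)%N by rewrite dimv0.
apply: le_trans (ereal_inf_lbound _) _; first by exists L0.
apply: ge_ereal_sup => _ [x Mx <-].
apply: (@le_trans _ _ (nrm (x - 0))%:E); last by rewrite subr0 lee_fin Ma.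
by apply: ereal_inf_lbound; exists 0 => //=; exact: mem0v.
Qed.

Lemma width_ge (R : realType) (V : vectType R) (nrm : V -> R) (n : nat)
    (M : set V) (a : R) :
  (forall L : {vspace V}, (\dim L <= n)%N ->
    exists2 x, M x & forall y, y \in L -> a <= nrm (x - y)) ->
  (a%:E <= kolmogorov_width nrm n M)%E.
Proof.
move=> Ma; apply: le_ereal_inf_tmp => _ [L Ln <-].
have [x Mx xa] := Ma L Ln.
apply: (@le_trans _ _
  (ereal_inf [set (nrm (x - y))%:E | y in [set y | y \in L]])).
  by apply: le_ereal_inf_tmp => _ [y yL <-]; rewrite lee_fin xa.
by apply: ereal_sup_ubound; exists x.
Qed.

(** Duality: pairing with [Z] annihilates [L], is at most the l_1 norm as the entries of [Z] have
    modulus at most 1, and sends the sign matrix of [Z] to the sum of these moduli. The sign matrix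
    is fixed before [s], so it can be scaled into the ball later. *)
Lemma far_sign_matrix (R : realType) (m k n : nat) (L : {vspace 'M[R]_(m, k)}) :
  (\dim L <= n)%N -> n%:R <= (m * k)%:R / 2 :> R ->
  exists2 x : 'M[R]_(m, k), forall i j, `|x i j| <= 1 &
    forall s y, y \in L ->
      s * (m * k)%:R / 2 <= mixed_norm 1%E 1%E (s *: x - y).
Proof.
move=> Ln nmk; have [Z [LZ Z1 cZ]] := exists_ortho_subspace L.
exists (map_mx Num.sg Z) => [i j|s y yL].
  by rewrite mxE normr_sg lern1 leq_b1.
have [s0|s0] := ltP s 0.
  apply: (@le_trans _ _ 0); last exact: lnorm_ge0.
  by rewrite pmulr_lle0 ?invr_gt0 // mulr_le0_ge0 // ltW.
have half : (m * k)%:R / 2 <= \sum_i \sum_j `|Z i j|.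
  apply: le_trans cZ; have : (\dim L)%:R <= n%:R :> R by rewrite ler_nat.
  have : (m * k <= m * k - \dim L + \dim L)%N by rewrite addnC -leq_subLR.
  rewrite -(ler_nat R) natrD; lra.
apply: (@le_trans _ _ (s * \sum_i \sum_j `|Z i j|)).
  by rewrite -mulrA ler_wpM2l.
have -> : s * \sum_i \sum_j `|Z i j| =
    \sum_i \sum_j (s *: map_mx Num.sg Z - y) i j * Z i j.
  rewrite -[LHS]subr0 -[X in _ - X](LZ y yL) mulr_sumr -sumrB.
  apply: eq_bigr => i _; rewrite mulr_sumr -sumrB; apply: eq_bigr => j _.
  by rewrite !mxE mulrBl -mulrA -normrEsg.
rewrite mixed_norm11; do 2![apply: ler_sum => ? _].
by rewrite (le_trans (ler_norm _)) // normrM ler_piMr.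
Qed.

Theorem proposition1 (R : realType) :
  exists c C : R, [/\ 0 < c, c <= C &
    forall p q theta sigma : \bar R,
      (1 <= q)%E -> (q <= p)%E -> (1 <= sigma)%E -> (sigma <= theta)%E ->
    forall m k n : nat, (0 < m)%N -> (0 < k)%N ->
      n%:R <= (m * k)%:R / 2 :> R ->
    let a : R := m%:R `^ (recip q - recip p)
                 * k%:R `^ (recip sigma - recip theta) in
    ((c * a)%:E <= kolmogorov_width (mixed_norm q sigma) n
                     (mixed_ball m k p theta))%E /\
    (kolmogorov_width (mixed_norm q sigma) n (mixed_ball m k p theta)
       <= (C * a)%:E)%E].

Proof.
exists (1 / 2), 1; split; [lra|lra|].
move=> p q theta sigma q1 qp s1 st m k n m0 k0 nmk a.
have p1 := le_trans q1 qp; have t1 := le_trans s1 st.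
have pw (N : nat) (u : R) : 0 < N%:R :> R -> 0 < N%:R `^ u by exact: powR_gt0.
have mR : 0 < m%:R :> R by rewrite ltr0n.
have kR : 0 < k%:R :> R by rewrite ltr0n.
have recip1 : recip 1%E = 1 :> R by rewrite /recip fine_invr invr1.
have recipy : recip +oo%E = 0 :> R by rewrite /recip invey.
split; last first.
  rewrite mul1r; apply: width_le_mixed_norm => x xB.
  apply: le_trans (mixed_norm_le x m0 k0 q1 qp s1 st) _.
  by rewrite -[leRHS]mulr1 ler_wpM2l ?mulr_ge0 ?powR_ge0.
apply: width_ge => L Ln.
have [x x1 xL] := far_sign_matrix Ln nmk.
(* With entries of modulus at most [s], comparison with the maximum norm puts the scaled sign matrix
   in the ball. *)
pose s : R := m%:R `^ (- recip p) * k%:R `^ (- recip theta).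
have s0 : 0 <= s by rewrite mulr_ge0 ?powR_ge0.
exists (s *: x).
  apply: le_trans (mixed_norm_le _ m0 k0 p1 (leey _) t1 (leey _)) _.
  have : mixed_norm +oo%E +oo%E (s *: x) <= s.
    apply: mixed_normyy_le => // i j.
    by rewrite mxE normrM ger0_norm // ler_piMr.
  rewrite recipy !subr0 => /(ler_wpM2l _) H.
  apply: le_trans (H _ _) _; first by rewrite mulr_ge0 ?powR_ge0.
  rewrite /s !powRN mulrACA !mulfV ?mulr1 //; exact/lt0r_neq0/pw.
move=> y yL.
(* Passing from l_1 to the (q, sigma) norm costs the factor [A]; the exponents then combine so that
   [A * a] equals [s] times mk. *)
have := le_trans (xL s y yL) (mixed_norm_le _ m0 k0 (lexx _) q1 (lexx _) s1).
rewrite recip1; set A := _ * k%:R `^ (1 - _) => lowE.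
have A0 : 0 < A by rewrite mulr_gt0 ?pw.
rewrite -(ler_pM2l A0); apply: le_trans lowE.
have powE (N : nat) (u v : R) : 0 < N%:R :> R ->
    N%:R `^ (1 - u) * N%:R `^ (u - v) = N%:R `^ (- v) * N%:R.
  move=> N0; have N1 := powRr1 (ltW N0).
  rewrite -[in X in _ = _ * X]N1 -!powRD ?lt0r_neq0 ?implybT //.
  by congr (_ `^ _); ring.
suff -> : A * (1 / 2 * a) = s * (m * k)%:R / 2 by [].
rewrite natrM /s [X in _ = X / 2]mulrACA
  -(powE m (recip q)) // -(powE k (recip sigma)) // /A /a; ring.
Qed.
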